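(* Let $\dot x = Ax+\sum_{i=1}^mB_iu_i$, $y_i=C_ix$ be an $n$-dimensional, jointly controllable and jointly observable $m$-channel continuous-time linear system (with $u_i\in\mathbb{R}^{p_i}$, $y_i\in\mathbb{R}^{q_i}$) whose neighbor graph is strongly connected. Let nonnegative integers $n_1,\dots,n_m$ be given and let $\{\bar A,\bar B_i,\bar C_i;m\}$ be the extended $m$-channel system of dimension $\bar n=n+\sum_i n_i$ with $$\bar A=\begin{bmatrix}A&0\\0&0\end{bmatrix},\quad \bar B_i=\begin{bmatrix}B_i&0\\0&E_i\end{bmatrix},\quad \bar C_i=\begin{bmatrix}C_i&0\\0&E_{\mathcal{N}_i}'\end{bmatrix},$$ where $E_i$ is the $(\sum_k n_k)\times n_i$ block column matrix whose $i$th block is $I_{n_i}$ and whose other blocks $\mathbf{0}_{n_k\times n_i}$ are zero, and for $\mathbf{s}=\{i_1<\dots<i_s\}\subset\{1,\dots,m\}$, $E_{\mathbf{s}}=[E_{i_1}\ \cdots\ E_{i_s}]$ (this models local controllers $\dot z_i=v_i$, $z_i\in\mathbb{R}^{n_i}$, with each agent $i$ measuring $y_i$ and the $z_j$, $j\in\mathcal{N}_i$). If $$n_i\ \ge\ n-\min_{\mathbf{s}\subset\{1,\dots,m\},\ \lambda\in\sigma(A)}\mathrm{rank}\begin{bmatrix}\lambda I_n-A & B_{\mathbf{s}}\\ C_{\{1,\dots,m\}-\mathbf{s}}&0\end{bmatrix}\quad\text{for all } i\in\{1,\dots,m\},$$ then the extended system $\{\bar A,\bar B_i,\bar C_i;m\}$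 has no fixed spectrum.
   Context: Jointly controllable: $(A,[B_1\ \cdots\ B_m])$ controllable; jointly observable: $(\mathrm{column}\{C_1,\dots,C_m\},A)$ observable. The neighbor graph is a directed graph on $\{1,\dots,m\}$ with an arc $j\to i$ iff $j$ is a neighbor of $i$; $\mathcal{N}_i$ is the set of neighbors of $i$ including $i$. For $\mathbf{s}=\{i_1<\dots<i_s\}$, $B_{\mathbf{s}}=[B_{i_1}\ \cdots\ B_{i_s}]$ and $C_{\mathbf{s}}=\mathrm{column}\{C_{i_1},\dots,C_{i_s}\}$ (empty when $\mathbf{s}=\emptyset$). $\sigma(A)$ is the spectrum of $A$. The fixed spectrum of an $m$-channel system $\{A,B_i,C_i;m\}$ is the set of eigenvalues of $A+\sum_{i=1}^mB_iF_iC_i$ that do not change as the real matrices $F_1,\dots,F_m$ range over all values. *)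

(* Defs.v *)
From HB Require Import structures.
From mathcomp Require Import all_boot all_order all_algebra fingraph.
From mathcomp Require Import reals complex.
Set Implicit Arguments. Unset Strict Implicit. Unset Printing Implicit Defensive.
Import Order.TTheory GRing.Theory Num.Theory.
Local Open Scope ring_scope.

Section Defs.
Variable R : realType.

Definition cmx (r c : nat) (M : 'M[R]_(r, c)) : 'M[R[i]]_(r, c) :=
  map_mx (fun x : R => (x%:C)%C) M.

Definition controllable (n k : nat) (A : 'M[R]_n) (B : 'M[R]_(n, k)) : bool :=
  \rank (\mxrow_(j < n) (A ^+ j *m B)) == n.
Definition observable (n k : nat) (C : 'M[R]_(k, n)) (A : 'M[R]_n) : bool :=
  \rank (\mxcol_(j < n) (C *m A ^+ j)) == n.

Definition Bsub (n m : nat) (p : 'I_m -> nat) (B : forall i, 'M[R]_(n, p i))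
    (s : {set 'I_m}) :=
  \mxrow_(k < #|s|) B (enum_val k).
Definition Csub (n m : nat) (q : 'I_m -> nat) (C : forall i, 'M[R]_(q i, n))
    (s : {set 'I_m}) :=
  \mxcol_(k < #|s|) C (enum_val k).

Definition jointly_controllable n m (p : 'I_m -> nat) (A : 'M[R]_n)
  (B : forall i, 'M[R]_(n, p i)) := controllable A (\mxrow_(i < m) B i).
Definition jointly_observable n m (q : 'I_m -> nat) (A : 'M[R]_n)
  (C : forall i, 'M[R]_(q i, n)) := observable (\mxcol_(i < m) C i) A.

Definition neighbor_arc m (N : 'I_m -> {set 'I_m}) : rel 'I_m :=
  fun j i => j \in N i.
Definition strongly_connected m (N : 'I_m -> {set 'I_m}) :=
  forall i j : 'I_m, connect (neighbor_arc N) i j.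

Definition in_spectrum n (A : 'M[R]_n) (lam : R[i]) := eigenvalue (cmx A) lam.

Definition in_fixed_spectrum n m (p q : 'I_m -> nat) (A : 'M[R]_n)
  (B : forall i, 'M[R]_(n, p i)) (C : forall i, 'M[R]_(q i, n)) (lam : R[i]) :=
  forall F : forall i, 'M[R]_(p i, q i),
    in_spectrum (A + \sum_i B i *m F i *m C i) lam.

Definition no_fixed_spectrum n m (p q : 'I_m -> nat) (A : 'M[R]_n)
  (B : forall i, 'M[R]_(n, p i)) (C : forall i, 'M[R]_(q i, n)) :=
  forall lam : R[i], ~ in_fixed_spectrum A B C lam.

Definition Eblk m (nn : 'I_m -> nat) (i : 'I_m) : 'M[R]_(\sum_k nn k, nn i) :=
  \mxcol_(k < m) (\matrix_(r < nn k, c < nn i) ((k == i) && (val r == val c))%:R).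
Definition Eset m (nn : 'I_m -> nat) (s : {set 'I_m}) :=
  \mxrow_(k < #|s|) Eblk nn (enum_val k).

Definition Abar n m (nn : 'I_m -> nat) (A : 'M[R]_n) : 'M[R]_(n + \sum_k nn k) :=
  block_mx A 0 0 0.
Definition Bbar n m (p nn : 'I_m -> nat) (B : forall i, 'M[R]_(n, p i)) (i : 'I_m)
  : 'M[R]_(n + \sum_k nn k, p i + nn i) :=
  block_mx (B i) 0 0 (Eblk nn i).
Definition Cbar n m (q nn : 'I_m -> nat) (N : 'I_m -> {set 'I_m})
  (C : forall i, 'M[R]_(q i, n)) (i : 'I_m) :=
  block_mx (C i) 0 0 (Eset nn (N i))^T.

End Defs.

(* Main.v *)
(* Following Anderson and Clements, [lam] is not a fixed eigenvalue as soon as the bordered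
   matrix [lam I - A, B_s; C_(s^c), 0] has rank at least the dimension for every set [s] of
   channels.  With one channel this follows by rank-one updates: if [rank X < d] then some
   column of [B] is outside the column space of [X] and some row of [C] is outside its row
   space, so that adding their product raises the rank.  Several channels are treated by
   induction, because a rank bound reached for one gain holds for generic gains.

   The bordered matrix of the extended system splits into that of the given system and
   [lam I, E_s; E_N(s^c)^T, 0].  The latter has rank at least [sum_k n_k], and by strong
   connectivity, for [s] nonempty and proper, at least [sum_k n_k + n_j] where [j] in [s] is
   a neighbor of a channel outside [s]; this compensates the defect of the former.  For [s]
   empty or full, the former has rank [n] by joint observability or controllability. *)

Require Import Defs.
From HB Require Import structures.
From mathcomp Require Import all_boot all_order all_algebra fingraph.
From mathcomp Require Import reals complex zify.
Set Implicit Arguments. Unset Strict Implicit. Unset Printing Implicit Defensive.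
Import Order.TTheory GRing.Theory Num.Theory.
Local Open Scope ring_scope.

(** * Rank along a line of matrices and under rank-one updates *)

Section RankOfPencils.
Variable K : fieldType.

(** [U] and [V] compress the pencil at [t0] to an identity of size its rank. The determinant of the
    compressed pencil is a polynomial in [t] with value 1 at [t0], and where it is nonzero the rank
    is at least that size. *)
Lemma rank_pencil r c (X Y : 'M[K]_(r, c)) (t0 : K) :
  exists2 p : {poly K}, p != 0 &
    forall t, p.[t] != 0 -> (\rank (X + t0 *: Y)%R <= \rank (X + t *: Y)%R)%N.
Proof.
set Z := X + t0 *: Y; set d := \rank Z.
pose U : 'M_(d, r) := pid_mx d *m invmx (col_ebase Z).
pose V : 'M_(c, d) := invmx (row_ebase Z) *m pid_mx d.
have UZV : U *m Z *m V = 1%:M.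
  rewrite /U /V -{2}(mulmx_ebase Z) !mulmxA mulmxKV ?col_ebase_unit //
    mulmxK ?row_ebase_unit //.
  by rewrite !pid_mx_id ?rank_leq_row ?rank_leq_col // pid_mx_1.
pose P := \det (map_mx polyC (U *m X *m V) + 'X *: map_mx polyC (U *m Y *m V)).
have PE t : P.[t] = \det (U *m (X + t *: Y) *m V).
  rewrite -horner_evalE -det_map_mx; congr (\det _).
  rewrite mulmxDr mulmxDl -scalemxAr -scalemxAl.
  move: (U *m X *m V) (U *m Y *m V) => X' Y'; apply/matrixP=> i j.
  by rewrite !mxE /= /horner_eval !hornerE.
exists P => [|t].
  apply/eqP=> P0; have := PE t0; rewrite P0 UZV det1 horner0.
  by move/eqP; rewrite eq_sym oner_eq0.
rewrite PE -unitfE -unitmxE => /mxrank_unit <-.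
exact: leq_trans (mxrankM_maxl _ _) (mxrankM_maxr _ _).
Qed.

Lemma rank_one_update r c (X : 'M[K]_(r, c)) (u : 'cV_r) (v : 'rV_c) :
  ~~ (u^T <= X^T)%MS -> ~~ (v <= X)%MS -> (\rank X < \rank (X + u *m v)%R)%N.
Proof.
move=> uX vX; set Y := X + u *m v.
pose W := (cokermx X^T)^T.
have WX : W *m X = 0 by apply: trmx_inj; rewrite trmx_mul trmxK mulmx_coker trmx0.
have [i wi] : exists i, (W *m u) i 0 != 0.
  move: uX; rewrite submxE -[cokermx _]trmxK -trmx_mul -/W trmx_eq0.
  by case/matrix0Pn=> i [j]; rewrite ord1; exists i.
(* Row [i] of [W] kills [X] but not [u], so it maps [Y] to a nonzero multiple of [v]. Hence the row
   space of [Y] contains [v], and then [X] too. *)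
have vY : (v <= Y)%MS.
  have: (row i W *m Y <= Y)%MS by exact: submxMl.
  rewrite mulmxDr mulmxA -row_mul WX row0 add0r -row_mul.
  suff -> : row i (W *m u) *m v = (W *m u) i 0 *: v by rewrite eqmx_scale.
  by rewrite [row i _]mx11_scalar mul_scalar_mx mxE.
have XY : (X <= Y)%MS.
  by rewrite -[X](addrK (u *m v)) addmx_sub ?eqmx_opp ?(submx_trans (submxMl _ _) vY).
have: (X < Y)%MS by rewrite /ltmx XY; apply: contra vX; apply: submx_trans.
by rewrite ltmxErank => /andP[].
Qed.

End RankOfPencils.

(** * Real gains that attain a rank bound over the larger field *)

Section FixedModes.
Variables (R : numFieldType) (K : fieldType) (f : {rmorphism R -> K}).

(** The naturals have distinct images in [K], too many to be all roots. This keeps the gains in [R]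
    although the polynomials have coefficients in [K]. *)
Lemma exists_nonroot (p : {poly K}) : p != 0 -> exists t : R, p.[f t] != 0.
Proof.
move=> p0; pose s := [seq f k%:R | k <- iota 0 (size p)].
have us : uniq s.
  rewrite map_inj_uniq ?iota_uniq // => x y /fmorph_inj /eqP.
  by rewrite eqr_nat => /eqP.
have /allPn[_ /mapP[k _ ->] hk] : ~~ all (poly.root p) s.
  by apply/negP=> /(max_poly_roots p0)/(_ us); rewrite size_map size_iota ltnn.
by exists k%:R; rewrite -rootE.
Qed.

(* A rank condition that can be met somewhere is met off a finite subset of any
   line through a witness, so finitely many such conditions have a common witness. *)
Lemma common_rank_witness (V : lmodType R) (S : eqType) (r : seq S) a b d
    (X : S -> V -> 'M[K]_(a, b)) :
  (forall s x y t, X s (x + t *: (y - x)) = X s x + f t *: (X s y - X s x)) ->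
  (forall s, s \in r -> exists x, (d <= \rank (X s x))%N) ->
  exists x, forall s, s \in r -> (d <= \rank (X s x))%N.
Proof.
move=> Xaff; elim: r => [|s0 r IHr] Xr; first by exists 0.
have [|x rx] := IHr; first by move=> s sr; apply: Xr; rewrite inE sr orbT.
have [|y ry] := Xr s0; first by rewrite inE eqxx.
have [p p0 pr] : exists2 p : {poly K}, p != 0 & forall t, p.[f t] != 0 ->
    forall s, s \in r -> (d <= \rank (X s (x + t *: (y - x))%R))%N.
  elim: r {IHr Xr} rx => [|s r IHr] rx; first by exists 1; rewrite ?oner_eq0.
  have [|p p0 pr] := IHr; first by move=> s' s'r; apply: rx; rewrite inE s'r orbT.
  (* Parameter 0 is the point [x], where the conditions in [r] hold; for [s0] the parameter 1, that
     is [y], is used instead. *)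
  have [q q0 qr] := rank_pencil (X s x) (X s y - X s x) 0.
  exists (p * q) => [|t]; first by rewrite mulf_neq0.
  rewrite hornerM mulf_eq0 negb_or => /andP[pt qt] s'.
  rewrite inE => /orP[/eqP->|]; last exact: pr.
  rewrite Xaff; apply: leq_trans (qr _ qt); rewrite scale0r addr0.
  by apply: rx; rewrite inE eqxx.
have [q q0 qr] := rank_pencil (X s0 x) (X s0 y - X s0 x) 1.
have [|t] := @exists_nonroot (p * q); first by rewrite mulf_neq0.
rewrite hornerM mulf_eq0 negb_or => /andP[pt qt].
exists (x + t *: (y - x)) => s; rewrite inE => /orP[/eqP->|]; last exact: pr.
rewrite Xaff; apply: leq_trans (qr _ qt).
by rewrite scale1r addrCA subrr addr0.
Qed.

Lemma single_channel_rank r c p q d (X : 'M[K]_(r, c)) (B : 'M[K]_(r, p)) (C : 'M[K]_(q, c)) :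
  (d <= \rank (row_mx X B))%N -> (d <= \rank (col_mx X C))%N ->
  exists F : 'M[R]_(p, q), (d <= \rank (X + B *m map_mx f F *m C)%R)%N.
Proof.
have [k] := ubnP (d - \rank X); elim: k X => // k IHk X le_k dB dC.
have [dX|Xd] := leqP d (\rank X).
  by exists 0; rewrite map_mx0 mulmx0 mul0mx addr0.
have [b ub] : exists b, ~~ ((col b B)^T <= X^T)%MS.
  have: ~~ (B^T <= X^T)%MS.
    apply: contraL dB => BX; rewrite -ltnNge; apply: leq_ltn_trans Xd.
    by rewrite -mxrank_tr -[leqRHS]mxrank_tr mxrankS // tr_row_mx col_mx_sub submx_refl.
  by case/row_subPn => b hb; exists b; rewrite tr_col.
have [a va] : exists a, ~~ (row a C <= X)%MS.
  have: ~~ (C <= X)%MS.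
    apply: contraL dC => CX; rewrite -ltnNge; apply: leq_ltn_trans Xd.
    by rewrite mxrankS // col_mx_sub submx_refl.
  by case/row_subPn => a ha; exists a.
(* A single unit entry joins the chosen column of [B] to the chosen row of [C]. *)
pose F0 : 'M[R]_(p, q) := delta_mx b a.
have F0E : B *m map_mx f F0 *m C = col b B *m row a C.
  rewrite map_delta_mx -[delta_mx b a](mul_delta_mx (0 : 'I_1)).
  by rewrite colE rowE !mulmxA.
have lt_r := rank_one_update ub va; rewrite -F0E in lt_r.
have [||| F1 hF1] := IHk (X + B *m map_mx f F0 *m C).
- by lia.
(* Both hypotheses survive the update: column operations by [B] undo it in [row_mx X B], and row
   operations by [C] undo it in [col_mx X C]. *)
- apply: leq_trans dB _; set G := map_mx f F0 *m C.
  suff -> : row_mx X B =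
      row_mx (X + B *m map_mx f F0 *m C) B *m block_mx 1%:M 0 (- G) 1%:M.
    exact: mxrankM_maxl.
  by rewrite mul_row_block !mulmx1 mulmx0 add0r mulmxN /G mulmxA addrK.
- apply: leq_trans dC _; set G := B *m map_mx f F0.
  suff -> : col_mx X C = block_mx 1%:M (- G) 0 1%:M *m col_mx (X + G *m C) C.
    exact: mxrankM_maxr.
  by rewrite mul_block_col !mul1mx mul0mx add0r mulNmx addrK.
by exists (F0 + F1); rewrite map_mxD mulmxDr mulmxDl addrA.
Qed.


Section Channels.
Variables (I : finType) (n d : nat) (p q : I -> nat).
Variables (B : forall i, 'M[K]_(n, p i)) (C : forall i, 'M[K]_(q i, n)).

(* Up to equality of row spaces, [Bspan s] is the paper's [B_s^T] and [Cspan s] is [C_s]. *)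
Definition Bspan (s : {set I}) : 'M[K]_n := (\sum_(i in s) <<(B i)^T>>)%MS.
Definition Cspan (s : {set I}) : 'M[K]_n := (\sum_(i in s) <<C i>>)%MS.

(** Isolates the columns of [B i] in the border, so that channel [i] can be treated as the only
    channel of a larger system whose state matrix is the bordered matrix for [s]. *)
Lemma extend_inputs (M : 'M[K]_n) (i : I) s (V : 'M[K]_n) :
  (\rank (block_mx M (Bspan (i |: s))^T V 0)
    <= \rank (row_mx (block_mx M (Bspan s)^T V 0) (col_mx (B i) 0)))%N.
Proof.
have /submxP[Z eZ] : (Bspan (i |: s) <= col_mx (Bspan s) (B i)^T)%MS.
  rewrite -addsmxE; apply/sumsmx_subP => j; rewrite !inE => /orP[/eqP->|js].
    by rewrite genmxE addsmxSr.
  by apply: submx_trans (addsmxSl _ _); apply: sumsmx_sup js _.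
have {}eZ : (Bspan (i |: s))^T =
    (Bspan s)^T *m usubmx Z^T + B i *m dsubmx Z^T.
  by rewrite eZ trmx_mul tr_col_mx trmxK -{1}[Z^T]vsubmxK mul_row_col.
suff -> : block_mx M (Bspan (i |: s))^T V 0 =
    row_mx (block_mx M (Bspan s)^T V 0) (col_mx (B i) 0) *m
    col_mx (block_mx 1%:M 0 0 (usubmx Z^T)) (row_mx 0 (dsubmx Z^T)).
  exact: mxrankM_maxl.
rewrite mul_row_col mulmx_block mul_col_row add_block_mx eZ.
by rewrite !(mulmx1, mulmx0, mul0mx, addr0, add0r).
Qed.

Lemma extend_outputs (M : 'M[K]_n) (i : I) s (U : 'M[K]_n) :
  (\rank (block_mx M U (Cspan (i |: s)) 0)
    <= \rank (col_mx (block_mx M U (Cspan s) 0) (row_mx (C i) 0)))%N.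
Proof.
have /submxP[Z eZ] : (Cspan (i |: s) <= col_mx (Cspan s) (C i))%MS.
  rewrite -addsmxE; apply/sumsmx_subP => j; rewrite !inE => /orP[/eqP->|js].
    by rewrite genmxE addsmxSr.
  by apply: submx_trans (addsmxSl _ _); apply: sumsmx_sup js _.
have {}eZ : Cspan (i |: s) = lsubmx Z *m Cspan s + rsubmx Z *m C i.
  by rewrite eZ -{1}[Z]hsubmxK mul_row_col.
suff -> : block_mx M U (Cspan (i |: s)) 0 =
    row_mx (block_mx 1%:M 0 0 (lsubmx Z)) (col_mx 0 (rsubmx Z)) *m
    col_mx (block_mx M U (Cspan s) 0) (row_mx (C i) 0).
  exact: mxrankM_maxr.
rewrite mul_row_col mulmx_block mul_col_row add_block_mx eZ.
by rewrite !(mul1mx, mulmx0, mul0mx, addr0, add0r).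
Qed.

(* The feedback gains are fixed one channel at a time; each must serve all the bordered
   matrices of the remaining channels simultaneously. *)
Lemma decentralized_rank (T : {set I}) (M : 'M[K]_n) :
  (forall s : {set I}, s \subset T ->
     (d <= \rank (block_mx M (Bspan s)^T (Cspan (T :\: s)) 0))%N) ->
  exists F : forall i, 'M[R]_(p i, q i),
    (d <= \rank (M + \sum_(i in T) B i *m map_mx f (F i) *m C i)%R)%N.
Proof.
have [k] := ubnP #|T|; elim: k T M => // k IHk T M le_k rkT.
have [T0|[i iT]] := set_0Vmem T.
  exists (fun _ => 0); rewrite T0 big_set0 addr0.
  have := rkT set0; rewrite T0 sub0set setD0 /Bspan /Cspan !big_set0 trmx0.
  move=> /(_ isT)/leq_trans; apply.
  suff -> : block_mx M 0 0 0 = col_mx 1%:M 0 *m M *m row_mx 1%:M 0 :> 'M_(n + n).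
    exact: leq_trans (mxrankM_maxl _ _) (mxrankM_maxr _ _).
  by rewrite mul_col_mx mul_col_row !(mul1mx, mulmx1, mulmx0, mul0mx).
pose X (s : {set I}) (F : 'M[R]_(p i, q i)) :=
  block_mx (M + B i *m map_mx f F *m C i) (Bspan s)^T (Cspan ((T :\ i) :\: s)) 0.
have [|s|Fi hFi] := @common_rank_witness _ _ (enum (powerset (T :\ i))) _ _ d X.
- move=> s x y t; rewrite /X opp_block_mx add_block_mx scale_block_mx add_block_mx.
  rewrite !subrr !scaler0 !addr0 map_mxD map_mxZ map_mxB; congr block_mx.
  rewrite opprD addrACA subrr add0r -mulNmx -mulmxN -mulmxDl -mulmxDr.
  by rewrite scalemxAl scalemxAr mulmxDr mulmxDl addrA.
- rewrite mem_enum inE => sT; have iNs : i \notin s.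
    by apply/negP => /(subsetP sT); rewrite !inE eqxx.
  have X_E F : X s F = block_mx M (Bspan s)^T (Cspan ((T :\ i) :\: s)) 0 +
      col_mx (B i) 0 *m map_mx f F *m row_mx (C i) 0.
    rewrite /X mul_col_mx mul_col_row add_block_mx.
    by rewrite !(mulmx0, mul0mx, addr0).
  (* The two conditions for this single channel are the given bounds for [i |: s] and for [s]. *)
  have [||F hF] := single_channel_rank (d := d) (B := col_mx (B i) 0) (C := row_mx (C i) 0)
    (X := block_mx M (Bspan s)^T (Cspan ((T :\ i) :\: s)) 0); last by exists F; rewrite X_E.
    apply: leq_trans (extend_inputs _ _ _ _); rewrite setDDl.
    by apply: rkT; rewrite subUset sub1set iT (subset_trans sT) ?subsetDl.
  apply: leq_trans (extend_outputs _ _ _ _).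
  suff -> : i |: ((T :\ i) :\: s) = T :\: s.
    by apply: rkT; rewrite (subset_trans sT) ?subsetDl.
  by apply/setP=> j; rewrite !inE; case: eqP => // ->; rewrite iNs iT.
have [||F hF] := IHk (T :\ i) (M + B i *m map_mx f Fi *m C i).
- by move: le_k; rewrite (cardsD1 i) iT.
- by move=> s sT; apply: hFi; rewrite mem_enum inE.
exists (dfwith F Fi); move: hF; rewrite -addrA [in X in _ -> X](big_setD1 i) //= dfwith_in.
congr (_ <= \rank (_ + (_ + _))%R)%N; apply: eq_bigr => j; rewrite !inE => /andP[ji _].
by rewrite dfwith_out // eq_sym.
Qed.

End Channels.
End FixedModes.

(** * Comparing, combining and bounding bordered matrices *)

Section BorderedMatrices.
Variable K : fieldType.

Lemma border_rankS n a a' b b' (M : 'M[K]_n) (U : 'M_(n, a)) (U' : 'M_(n, a'))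
    (V : 'M_(b, n)) (V' : 'M_(b', n)) :
  (U^T <= U'^T)%MS -> (V <= V')%MS ->
  (\rank (block_mx M U V 0) <= \rank (block_mx M U' V' 0))%N.
Proof.
case/submxP=> X eU /submxP[Y ->].
have -> : U = U' *m X^T by rewrite -[U]trmxK eU trmx_mul trmxK.
suff -> : block_mx M (U' *m X^T) (Y *m V') 0 =
    block_mx 1%:M 0 0 Y *m block_mx M U' V' 0 *m block_mx 1%:M 0 0 X^T.
  exact: leq_trans (mxrankM_maxl _ _) (mxrankM_maxr _ _).
rewrite !mulmx_block !(mul1mx, mulmx1, mul0mx, mulmx0).
by rewrite !(addr0, add0r, mul0mx).
Qed.

(** The borders may be shrunk to block diagonal ones by [border_rankS]; the block permutations [L]
    and [Q] then regroup rows and columns by subsystem, leaving a direct sum. *)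
Lemma border_rankD n1 n2 a1 a2 a b1 b2 b (M1 : 'M[K]_n1) (M2 : 'M[K]_n2)
    (B1 : 'M_(n1, a1)) (B2 : 'M_(n2, a2)) (C1 : 'M_(b1, n1)) (C2 : 'M_(b2, n2))
    (U : 'M_(n1 + n2, a)) (V : 'M_(b, n1 + n2)) :
  (row_mx B1^T 0 <= U^T)%MS -> (row_mx 0 B2^T <= U^T)%MS ->
  (row_mx C1 0 <= V)%MS -> (row_mx 0 C2 <= V)%MS ->
  (\rank (block_mx M1 B1 C1 0) + \rank (block_mx M2 B2 C2 0) <=
   \rank (block_mx (block_mx M1 0 0 M2) U V 0))%N.
Proof.
move=> B1U B2U C1V C2V.
pose X : 'M_(n1 + n2 + (b1 + b2), n1 + n2 + (a1 + a2)) :=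
  block_mx (block_mx M1 0 0 M2) (block_mx B1 0 0 B2) (block_mx C1 0 0 C2) 0.
have XU : (\rank X <= \rank (block_mx (block_mx M1 0 0 M2) U V 0))%N.
  by apply: border_rankS; rewrite ?tr_block_mx ?trmx0 col_mx_sub ?B1U ?C1V.
apply: leq_trans XU; rewrite -rank_diag_block_mx.
pose L : 'M[K]_(n1 + b1 + (n2 + b2), n1 + n2 + (b1 + b2)) :=
  block_mx (block_mx 1%:M 0 0 0) (block_mx 0 0 1%:M 0)
           (block_mx 0 1%:M 0 0) (block_mx 0 0 0 1%:M).
pose Q : 'M[K]_(n1 + n2 + (a1 + a2), n1 + a1 + (n2 + a2)) :=
  block_mx (block_mx 1%:M 0 0 0) (block_mx 0 0 1%:M 0)
           (block_mx 0 1%:M 0 0) (block_mx 0 0 0 1%:M).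
suff -> : block_mx (block_mx M1 B1 C1 0) 0 0 (block_mx M2 B2 C2 0) = L *m X *m Q.
  exact: leq_trans (mxrankM_maxl _ _) (mxrankM_maxr _ _).
rewrite /L /X /Q !mulmx_block !(mul1mx, mulmx1, mul0mx, mulmx0).
rewrite !add_block_mx !(addr0, add0r) !mulmx_block !(mul1mx, mulmx1, mul0mx, mulmx0).
by rewrite !add_block_mx !(addr0, add0r) -!block_mx0.
Qed.

(* The terms [i] in [s] of [1 = sum_i E_i E_i^T] are reached through [U], the others
   through [V]; adding [1 - lam] times each of them to the corner turns it into [1]. *)
Lemma integrator_border_rank (I : finType) n g (k : I -> nat) (s : {set I})
    (E : forall i, 'M[K]_(n, k i)) (G : 'M[K]_(n, g)) (lam : K) (U V : 'M_n) :
  \sum_i E i *m (E i)^T = 1%:M -> G^T *m G = 1%:M ->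
  (forall i, i \in s -> ((E i)^T <= U)%MS) ->
  (forall i, i \notin s -> ((E i)^T <= V)%MS) ->
  (G^T <= U)%MS -> (G^T <= V)%MS ->
  (n + g <= \rank (block_mx lam%:M U^T V 0))%N.
Proof.
move=> E1 G1 EU EV /submxP[W1 GU] /submxP[W2 GV].
pose Q1 := \sum_(i in s) E i *m (E i)^T; pose Q2 := \sum_(i | i \notin s) E i *m (E i)^T.
have Q12 : Q1 + Q2 = 1%:M by rewrite -E1 (bigID (mem s)).
have trQ1 : Q1^T = Q1.
  by rewrite /Q1 linear_sum; apply: eq_bigr => i _ /=; rewrite trmx_mul trmxK.
have /submxP[Z1 eQ1] : (Q1 <= U)%MS.
  by apply: summx_sub => i si; apply: submx_trans (submxMl _ _) (EU i si).
have /submxP[Z2 eQ2] : (Q2 <= V)%MS.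
  by apply: summx_sub => i si; apply: submx_trans (submxMl _ _) (EV i si).
(* [Y] is invertible: the Schur complement of its corner 1 is [- G^T *m G], which is -1. *)
pose Y : 'M[K]_(n + g) := block_mx 1%:M G G^T 0.
have -> : (n + g)%N = \rank Y.
  have -> : Y = block_mx 1%:M 0 G^T 1%:M *m block_mx 1%:M G 0 (- 1%:M).
    rewrite mulmx_block !(mul1mx, mulmx1, mul0mx, mulmx0) G1.
    by rewrite addr0 addr0 subrr addr0.
  apply/esym/mxrank_unit; rewrite unitmx_mul !unitmxE det_lblock det_ublock.
  by rewrite !det1 !mul1r unitr1 -scaleN1r detZ det1 mulr1 unitrX ?unitrN1.
suff -> : Y = block_mx 1%:M ((1 - lam) *: Z2) 0 W2 *m block_mx lam%:M U^T V 0 *m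
    block_mx 1%:M 0 ((1 - lam) *: Z1^T) W1^T.
  exact: leq_trans (mxrankM_maxl _ _) (mxrankM_maxr _ _).
rewrite !mulmx_block !(mul1mx, mulmx1, mul0mx, mulmx0) !(addr0, add0r, mul0mx).
rewrite -GV -scalemxAl -scalemxAr -eQ2 -!trmx_mul -GU -eQ1 trQ1 trmxK.
rewrite -addrA -scalerDr [Q2 + _]addrC Q12 -[lam%:M]scalemx1 -scalerDl.
by rewrite [lam + _]addrC subrK scale1r.
Qed.

(** Turns a containment for a zero-padded [X] into one for [X] itself, which can then be checked
    channel by channel. *)
Lemma sub_mulmx a b n k (X : 'M[K]_(a, n)) (P : 'M_(n, k)) (U : 'M_(b, k)) :
  (X *m P <= U)%MS = (X <= kermx (P *m cokermx U))%MS.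
Proof. by rewrite submxE sub_kermx mulmxA. Qed.

Lemma sub_mxrow m n (p : 'I_m -> nat) (X : forall i, 'M[K]_(n, p i)) i :
  ((X i)^T <= (\mxrow_j X j)^T)%MS.
Proof. by rewrite tr_mxrow eqmx_col (sumsmx_sup i) // genmxE. Qed.

Lemma mxrow_subP m n w (p : 'I_m -> nat) (X : forall i, 'M[K]_(n, p i)) (W : 'M_(w, n)) :
  (forall i, ((X i)^T <= W)%MS) -> ((\mxrow_j X j)^T <= W)%MS.
Proof. by move=> XW; rewrite tr_mxrow eqmx_col; apply/sumsmx_subP => i _; rewrite genmxE. Qed.

Lemma mxcol_subP m n w (p : 'I_m -> nat) (X : forall i, 'M[K]_(p i, n)) (W : 'M_(w, n)) :
  (forall i, (X i <= W)%MS) -> (\mxcol_j X j <= W)%MS.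
Proof. by move=> XW; rewrite eqmx_col; apply/sumsmx_subP => i _; rewrite genmxE. Qed.

Lemma eigenrow_expr n (A : 'M[K]_n) (v : 'rV_n) (lam : K) j :
  v *m A = lam *: v -> v *m A ^+ j = lam ^+ j *: v.
Proof.
move=> vA; elim: j => [|j IHj]; first by rewrite !expr0 scale1r mulmx1.
rewrite exprS exprSr; change (v *m (A *m A ^+ j) = (lam ^+ j * lam) *: v).
by rewrite mulmxA vA -scalemxAl IHj scalerA mulrC.
Qed.

End BorderedMatrices.

(** Follow the path from [x] up to its first arc that leaves [s]. *)
Lemma exit_arc (T : finType) (e : rel T) (s : {set T}) x y :
  connect e x y -> x \in s -> y \notin s ->
  exists u v, [/\ u \in s, v \notin s & e u v].
Proof.
case/connectP=> w; elim: w x => [|z w IHw] x /= => [_ -> -> //|/andP[xz zw] ey xs ys].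
have [zs|zs] := boolP (z \in s); first exact: IHw zw ey zs ys.
by exists x, z.
Qed.

(** * Passage to complex matrices, and the bordered ranks of both systems *)

Section ExtendedSystem.
Variable R : realType.
Local Notation toC := (real_complex R).

Lemma cmxE r c (M : 'M[R]_(r, c)) : cmx M = map_mx toC M. Proof. by []. Qed.

Lemma cmx_mxrow m n (p : 'I_m -> nat) (X : forall i, 'M[R]_(n, p i)) :
  cmx (\mxrow_i X i) = \mxrow_i cmx (X i).
Proof. by apply/matrixP=> i j; rewrite !mxE. Qed.

Lemma cmx_mxcol m n (p : 'I_m -> nat) (X : forall i, 'M[R]_(p i, n)) :
  cmx (\mxcol_i X i) = \mxcol_i cmx (X i).
Proof. by apply/matrixP=> i j; rewrite !mxE. Qed.

Lemma tr_cmx r c (M : 'M[R]_(r, c)) : (cmx M)^T = cmx M^T.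
Proof. by rewrite !cmxE map_trmx. Qed.

Lemma cmx_expr n (A : 'M[R]_n) j : cmx (A ^+ j) = cmx A ^+ j.
Proof.
elim: j => [|j IHj]; first by rewrite !expr0 cmxE map_mx1.
rewrite !exprS -IHj; change (cmx (A *m A ^+ j) = cmx A *m cmx (A ^+ j)).
by rewrite !cmxE map_mxM.
Qed.

(** Popov-Belevitch-Hautus test: a row that kills both blocks is a left eigenvector of [A] that
    kills [B], hence kills every [A ^+ j *m B] and must vanish. *)
Lemma controllable_row_free n k (A : 'M[R]_n) (B : 'M[R]_(n, k)) (lam : R[i]) :
  controllable A B -> row_free (row_mx (lam%:M - cmx A) (cmx B)).
Proof.
move=> /eqP ctrl; apply: inj_row_free => v; rewrite mul_mx_row.
move/eqP; rewrite -[X in _ == X]row_mx0 => /eqP/eq_row_mx[].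
rewrite mulmxBr mul_mx_scalar => /eqP; rewrite subr_eq0 => /eqP/esym vA vB.
have: row_free (cmx (\mxrow_(j < n) (A ^+ j *m B))).
  by rewrite /row_free cmxE mxrank_map ctrl.
move/mulmx_free_eq0 => /(_ _ v) inj; apply/eqP; rewrite -inj cmx_mxrow mul_mxrow.
apply/eqP; rewrite -[RHS]mxrow0; apply: eq_mxrow => j.
rewrite cmxE map_mxM mulmxA -cmxE cmx_expr (eigenrow_expr _ vA).
by rewrite -scalemxAl vB scaler0.
Qed.

Lemma observable_tr n k (A : 'M[R]_n) (C : 'M[R]_(k, n)) :
  observable C A = controllable A^T C^T.
Proof.
rewrite /observable /controllable -mxrank_tr tr_mxcol.
suff -> : \mxrow_(j < n) (C *m A ^+ j)^T = \mxrow_(j < n) (A^T ^+ j *m C^T) by [].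
apply: eq_mxrow => j; rewrite trmx_mul; congr (_ *m _).
elim: (nat_of_ord j) => [|l IHl]; first by rewrite !expr0 trmx1.
rewrite exprS exprSr -IHl; exact: trmx_mul.
Qed.

(** As block columns of the identity, the [E_i] have orthonormal columns and the products
    [E_i E_i^T] sum to 1. *)
Lemma Eblk_submxrow m (nn : 'I_m -> nat) i : Eblk R nn i = submxrow 1%:M i.
Proof.
apply/matrixP=> r c; rewrite !mxE -[in RHS](tagnat.sig2K r).
by rewrite -tagnat.eq_Rank.
Qed.

Lemma sum_Eblk m (nn : 'I_m -> nat) :
  \sum_i cmx (Eblk R nn i) *m (cmx (Eblk R nn i))^T = 1%:M.
Proof.
have -> : 1%:M = cmx (\mxrow_i Eblk R nn i *m (\mxrow_i Eblk R nn i)^T).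
  rewrite (eq_mxrow (fun i => Eblk_submxrow nn i)) submxrowK trmx1 mulmx1.
  by rewrite cmxE map_mx1.
rewrite cmxE map_mxM -cmxE -map_trmx -cmxE cmx_mxrow tr_mxrow mul_mxrow_mxcol.
by [].
Qed.

Lemma Eblk_orthonormal m (nn : 'I_m -> nat) i :
  (cmx (Eblk R nn i))^T *m cmx (Eblk R nn i) = 1%:M.
Proof.
rewrite tr_cmx !cmxE -map_mxM Eblk_submxrow tr_submxrow trmx1.
rewrite mul_submxrow mulmx1 -[1%:M in RHS](map_mx1 toC); congr map_mx.
by apply/matrixP=> r c; rewrite !mxE -[in LHS]val_eqE tagnat.eq_Rank eqxx.
Qed.

Lemma sub_cmx_Bsub n m (p : 'I_m -> nat) (B : forall i, 'M[R]_(n, p i)) (s : {set 'I_m}) i :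
  i \in s -> ((cmx (B i))^T <= (cmx (Bsub B s))^T)%MS.
Proof.
move=> si; rewrite -(enum_rankK_in si si) cmx_mxrow.
exact: (sub_mxrow (fun k => cmx (B (enum_val k)))).
Qed.

Lemma cmx_Bsub_subP n m w (p : 'I_m -> nat) (B : forall i, 'M[R]_(n, p i))
    (s : {set 'I_m}) (W : 'M_(w, n)) :
  (forall i, i \in s -> ((cmx (B i))^T <= W)%MS) -> ((cmx (Bsub B s))^T <= W)%MS.
Proof.
by move=> BW; rewrite cmx_mxrow; apply: mxrow_subP => k; apply/BW/enum_valP.
Qed.

Lemma cmx_Csub_subP n m w (q : 'I_m -> nat) (C : forall i, 'M[R]_(q i, n))
    (s : {set 'I_m}) (W : 'M_(w, n)) :
  (forall i, i \in s -> (cmx (C i) <= W)%MS) -> (cmx (Csub C s) <= W)%MS.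
Proof.
by move=> CW; rewrite cmx_mxcol; apply: mxcol_subP => k; apply/CW/enum_valP.
Qed.

Lemma sub_cmx_Csub n m (q : 'I_m -> nat) (C : forall i, 'M[R]_(q i, n)) (s : {set 'I_m}) i :
  i \in s -> (cmx (C i) <= cmx (Csub C s))%MS.
Proof.
move=> si; rewrite -(enum_rankK_in si si) cmx_mxcol eqmx_col.
by rewrite (sumsmx_sup (enum_rank_in si i)) // genmxE.
Qed.

Section System.
Variables (n m : nat) (p q nn : 'I_m -> nat) (A : 'M[R]_n).
Variables (B : forall i, 'M[R]_(n, p i)) (C : forall i, 'M[R]_(q i, n)).
Variables (N : 'I_m -> {set 'I_m}).

Definition system_rank (lam : R[i]) s :=
  \rank (block_mx (lam%:M - cmx A) (cmx (Bsub B s)) (cmx (Csub C (~: s))) 0).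

Lemma system_rankT lam : jointly_controllable A B -> (n <= system_rank lam setT)%N.
Proof.
move=> /(controllable_row_free lam)/eqP rkAB.
apply: (@leq_trans (\rank (row_mx (lam%:M - cmx A) (cmx (Bsub B setT))))).
  rewrite -[leqLHS]rkAB -mxrank_tr -[leqRHS]mxrank_tr mxrankS // !tr_row_mx.
  rewrite col_mx_sub -!addsmxE addsmxSl cmx_mxrow.
  apply: mxrow_subP => i; apply: submx_trans (addsmxSr _ _).
  by apply: sub_cmx_Bsub; rewrite inE.
by rewrite /system_rank /block_mx mxrankS // -addsmxE addsmxSl.
Qed.

Lemma system_rank0 lam : jointly_observable A C -> (n <= system_rank lam set0)%N.
Proof.
rewrite /jointly_observable observable_tr => /(controllable_row_free lam)/eqP rkAC.
apply: (@leq_trans (\rank (col_mx (lam%:M - cmx A) (cmx (Csub C (~: set0)))))).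
  rewrite -[leqLHS]rkAC -mxrank_tr mxrankS // tr_row_mx.
  rewrite linearB /= tr_scalar_mx !tr_cmx !trmxK.
  rewrite col_mx_sub -!addsmxE addsmxSl cmx_mxcol.
  apply: mxcol_subP => i; apply: submx_trans (addsmxSr _ _).
  by apply: sub_cmx_Csub; rewrite !inE.
rewrite /system_rank block_mxEh -mxrank_tr -[leqRHS]mxrank_tr mxrankS // tr_row_mx.
by rewrite -addsmxE addsmxSl.
Qed.

Lemma system_rank_nonspectrum lam s : ~~ in_spectrum A lam -> (n <= system_rank lam s)%N.
Proof.
rewrite /in_spectrum /eigenvalue /eigenspace negbK kermx_eq0 => /eqP rkA.
rewrite -[leqLHS]rkA -mxrank_opp opprB /system_rank; set X := block_mx _ _ _ _.
have XE : lam%:M - cmx A = row_mx 1%:M 0 *m X *m col_mx 1%:M 0.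
  by rewrite mul_row_block mul_row_col !(mul1mx, mulmx1, mul0mx, mulmx0, addr0).
rewrite {1}XE; exact: leq_trans (mxrankM_maxl _ _) (mxrankM_maxr _ _).
Qed.

(** The columns of [G] are integrator directions that can be both actuated by channels in [s] and
    measured by channels outside [s]; each adds one to the rank. *)
Lemma extended_rank lam (s : {set 'I_m}) g (G : 'M[R[i]]_(\sum_k nn k, g)) :
  (forall i, i \in N i) -> G^T *m G = 1%:M ->
  (G^T <= Bspan (fun i => cmx (Eblk R nn i)) s)%MS ->
  (G^T <= Cspan (fun i => (cmx (Eset R nn (N i)))^T) (~: s))%MS ->
  (system_rank lam s + (\sum_k nn k + g) <=
   \rank (block_mx (lam%:M - cmx (Abar nn A)) (Bspan (fun i => cmx (Bbar nn B i)) s)^T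
                   (Cspan (fun i => cmx (Cbar nn N C i)) (~: s)) 0))%N.
Proof.
move=> Nii G1 GB GC.
set U := Bspan _ s; set V := Cspan _ _.
have UB i : i \in s -> ((cmx (Bbar nn B i))^T <= U)%MS.
  by move=> si; apply: sumsmx_sup si _; rewrite genmxE.
have VC i : i \in ~: s -> (cmx (Cbar nn N C i) <= V)%MS.
  by move=> si; apply: sumsmx_sup si _; rewrite genmxE.
have -> : lam%:M - cmx (Abar nn A) = block_mx (lam%:M - cmx A) 0 0 lam%:M.
  rewrite scalar_mx_block cmxE map_block_mx !map_mx0 opp_block_mx add_block_mx.
  by rewrite !oppr0 !addr0.
have row_l k (X : 'M_(k, n)) : row_mx X 0 = X *m row_mx 1%:M (0 : 'M_(n, \sum_i nn i)).
  by rewrite mul_mx_row mulmx1 mulmx0.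
have row_r k (X : 'M_(k, \sum_i nn i)) : row_mx 0 X = X *m row_mx (0 : 'M_(_, n)) 1%:M.
  by rewrite mul_mx_row mulmx1 mulmx0.
pose E i := cmx (Eblk R nn i).
have le2 := integrator_border_rank lam (E := E) (s := s) (sum_Eblk nn) G1 _ _ GB GC.
apply: leq_trans (leq_add (leqnn _) (le2 _ _)) _.
- by move=> i si; apply: sumsmx_sup si _; rewrite genmxE.
(* Each agent measures its own [z_i], by [Nii]. *)
- move=> i si; apply: (@sumsmx_sup _ _ i); first by rewrite inE.
  by rewrite genmxE; apply: sub_cmx_Bsub.
apply: border_rankD; rewrite ?trmxK.
- rewrite row_l sub_mulmx; apply: cmx_Bsub_subP => i /UB; rewrite -sub_mulmx -row_l.
  apply: submx_trans; rewrite !cmxE /Bbar map_block_mx tr_block_mx !map_mx0 !trmx0.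
  by rewrite -addsmxE addsmxSl.
- rewrite row_r sub_mulmx; apply/sumsmx_subP => i /UB UBi.
  rewrite genmxE -sub_mulmx -row_r; apply: submx_trans UBi.
  rewrite !cmxE /Bbar map_block_mx tr_block_mx !map_mx0 !trmx0.
  by rewrite -addsmxE addsmxSr.
- rewrite row_l sub_mulmx; apply: cmx_Csub_subP => i /VC; rewrite -sub_mulmx -row_l.
  apply: submx_trans; rewrite !cmxE /Cbar map_block_mx !map_mx0.
  by rewrite -addsmxE addsmxSl.
rewrite row_r sub_mulmx; apply/sumsmx_subP => i /VC VCi.
rewrite genmxE -sub_mulmx -row_r; apply: submx_trans VCi.
rewrite tr_cmx !cmxE /Cbar map_block_mx !map_mx0.
by rewrite -addsmxE addsmxSr.
Qed.

End System.
End ExtendedSystem.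

Theorem theorem2 (R : realType) (n m : nat) (p q : 'I_m -> nat)
  (A : 'M[R]_n) (B : forall i, 'M[R]_(n, p i)) (C : forall i, 'M[R]_(q i, n))
  (N : 'I_m -> {set 'I_m}) (nn : 'I_m -> nat) :
  jointly_controllable A B ->
  jointly_observable A C ->
  (forall i, i \in N i) ->
  strongly_connected N ->
  (forall i : 'I_m, forall s : {set 'I_m}, forall lam : R[i],
     in_spectrum A lam ->
     (n <= nn i + \rank (block_mx (lam%:M - cmx A) (cmx (Bsub B s))
                                  (cmx (Csub C (~: s))) 0))%N) ->
  no_fixed_spectrum (Abar nn A) (Bbar nn B) (Cbar nn N C).
Proof.
move=> ctrl obs Nii conn rk lam fixed.
pose MB i := cmx (Bbar nn B i); pose MC i := cmx (Cbar nn N C i).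
have [|F hF] := @decentralized_rank R R[i] (real_complex R) 'I_m (n + \sum_k nn k)
    (n + \sum_k nn k) _ _ MB MC setT (lam%:M - cmx (Abar nn A)).
  move=> s _; rewrite setTD.
  have [ns|rk_lt] := leqP n (system_rank A B C lam s).
    (* There is no defect to compensate, so [G] has no columns. *)
    apply: leq_trans _ (@extended_rank R n m p q nn A B C N lam s 0 0 Nii _ _ _).
    - by rewrite addn0 leq_add2r.
    - by apply/matrixP=> -[].
    - by rewrite trmx0 sub0mx.
    by rewrite trmx0 sub0mx.
  have lamA : in_spectrum A lam.
    by apply: contraLR rk_lt; rewrite -leqNgt; apply: system_rank_nonspectrum.
  have [x sx] : exists x, x \in s.
    apply/set0Pn; apply: contraTneq rk_lt => ->.
    by rewrite -leqNgt system_rank0.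
  have [y sy] : exists y, y \notin s.
    have : ~: s != set0.
      apply: contraTneq rk_lt => s0; rewrite -leqNgt -[s]setCK s0 setC0.
      by rewrite system_rankT.
    by case/set0Pn=> y; rewrite inE; exists y.
  (* Channel [k] in [s] drives [z_k], and [j] outside [s] measures it. So [G] can be [E_k], whose
     [nn k] columns make up for the defect of [system_rank]. *)
  have [k [j [sk sj Njk]]] := exit_arc (conn x y) sx sy.
  have := extended_rank A B C lam Nii (Eblk_orthonormal R nn k) (s := s).
  move=> le; apply: leq_trans (le _ _).
  - by have := rk k s lam lamA; rewrite -/(system_rank A B C lam s); lia.
  - by apply: sumsmx_sup sk _; rewrite genmxE.
  apply: (@sumsmx_sup _ _ j); first by rewrite inE.
  by rewrite genmxE; apply: sub_cmx_Bsub.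
(* The sign change turns [lam - Abar + sum MB F MC] into [lam] minus a closed-loop matrix; its full
   rank contradicts that [lam] is an eigenvalue. *)
have := fixed (fun i => - F i); rewrite /in_spectrum /eigenvalue /eigenspace kermx_eq0.
apply/negP; rewrite negbK /row_free eqn_leq rank_leq_row.
rewrite -mxrank_opp opprB; apply: leq_trans hF _; rewrite eq_leq //; congr (\rank _).
rewrite !cmxE map_mxD opprD addrA; congr (_ + _).
rewrite raddf_sum -sumrN; apply: eq_big => [i|i _]; first by rewrite inE.
by rewrite /= !map_mxM map_mxN mulmxN mulNmx opprK.
Qed.
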